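(* There exist absolute constants $c,C\ge 1$ and an online scheduler $\texttt{ALG}$ for the serial-parallel scheduling problem that does not use cancelling, such that for every task arrival process $\mathcal{T}$, $$\mathrm{TRT}_{\texttt{ALG}}^{\mathcal{T}}\le C\cdot \mathrm{TRT}_{\texttt{OPT}}^{c\cdot\mathcal{T}};$$ that is, with $O(1)$ speed augmentation and without cancelling, $\texttt{ALG}$ is $O(1)$-competitive for mean response time.
   Context: Serial-parallel scheduling problem: $p$ identical processors ($p$ at least a sufficiently large constant). A task arrival process (TAP) is a finite set of tasks $\tau_i=(\sigma_i,\pi_i,t_i)$, $i=1,\dots,n$, with arrival time $t_i\ge0$, serial work $\sigma_i$ and parallel work $\pi_i$, $1\le\pi_i/\sigma_i\le p$. A task is performed either by its serial job (work $\sigma_i$, at most one processor at any instant) or by its parallel job (work $\pi_i$, any number of processors, rate equal to number of processors). Time is continuous; processors are allocated (fractionally via time sharing) among arrived unfinished jobs; a job completes when the integral of its allocated processors reaches its work. Before starting a task the scheduler irrevocably chooses an implementation (no cancelling/restarting with the other implementation); preemption is allowed. An online scheduler learns about a task only at its arrival. The total response time $\mathrm{TRT}^{\mathcal{T}}_{\texttt{ALG}}=\sum_i(f_i-t_i)$, where $f_i$ is the completion time of $\tau_i$; mean response time is $\mathrm{TRT}/n$. $\mathrm{TRT}^{\mathcal{T}}_{\texttt{OPT}}$ is the minimum total response time achievable by an offline schedule on $\mathcal{T}$. For $c>0$, $c\cdot\mathcal{T}$ is $\mathcal{T}$ with all serial and parallel works multiplied by $c$ (equivalently, $\texttt{ALG}$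 runs on processors $c$ times faster than $\texttt{OPT}$'s). *)

(* Defs.v *)
From HB Require Import structures.
From mathcomp Require Import all_boot all_order all_algebra.
From mathcomp Require Import all_classical all_reals all_analysis.
Set Implicit Arguments. Unset Strict Implicit. Unset Printing Implicit Defensive.
Import Order.TTheory GRing.Theory Num.Theory.
Local Open Scope ring_scope.
Local Open Scope classical_set_scope.

Section SerialParallel.
Variable R : realType.

Record task := Task { serial_work : R; par_work : R; arrival : R }.

Definition dtask : task := Task 0 0 0.

(* A task arrival process: a finite list of tasks, listed in nondecreasing
   order of arrival (any finite set of tasks can be so listed). *)
Definition TAP := seq task.

Definition valid_task (p : nat) (tau : task) : Prop :=
  [/\ 0 < serial_work tau,
      serial_work tau <= par_work tau,
      par_work tau <= p%:R * serial_work tau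
    & 0 <= arrival tau].

Definition valid_tap (p : nat) (T : TAP) : Prop :=
  (forall i, (i < size T)%N -> valid_task p (nth dtask T i)) /\
  (forall i j, (i <= j)%N -> (j < size T)%N ->
     arrival (nth dtask T i) <= arrival (nth dtask T j)).

Definition scale_tap (c : R) (T : TAP) : TAP :=
  map (fun tau => Task (c * serial_work tau) (c * par_work tau) (arrival tau)) T.

(* A schedule for a TAP: for task i, the chosen implementation
   (true = parallel job, false = serial job), the (fractional) number of
   processors allocated to it at each instant, and its completion time. *)
Record schedule := Schedule {
  sch_par : nat -> bool;
  sch_alloc : nat -> R -> R;
  sch_compl : nat -> R }.

Definition work (tau : task) (par : bool) : R :=
  if par then par_work tau else serial_work tau.

Definition processed (S : schedule) (i : nat) (s : R) : \bar R :=
  (\int[@lebesgue_measure R]_(x in [set x : R | (x <= s)%R]) (sch_alloc S i x)%:E)%E.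

Definition feasible (p : nat) (T : TAP) (S : schedule) : Prop :=
  (forall i, (i < size T)%N ->
     let tau := nth dtask T i in
     [/\ measurable_fun setT (sch_alloc S i),
         (forall x, 0 <= sch_alloc S i x),
         (forall x, x < arrival tau -> sch_alloc S i x = 0)
       & (~~ sch_par S i -> forall x, sch_alloc S i x <= 1)] /\
     [/\ (forall x, sch_compl S i < x -> sch_alloc S i x = 0),
         processed S i (sch_compl S i) = (work tau (sch_par S i))%:E
       & (forall s, s < sch_compl S i ->
            (processed S i s < (work tau (sch_par S i))%:E)%E)]) /\
  (forall x, \sum_(i < size T) sch_alloc S i x <= p%:R).

Definition TRT (T : TAP) (S : schedule) : R :=
  \sum_(i < size T) (sch_compl S i - arrival (nth dtask T i)).

Definition online (p : nat) (ALG : TAP -> schedule) : Prop :=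
  forall (T T' : TAP) (s : R) (k : nat),
    valid_tap p T -> valid_tap p T' ->
    (k <= size T)%N -> (k <= size T')%N ->
    take k T = take k T' ->
    (forall i, (k <= i)%N -> (i < size T)%N -> s < arrival (nth dtask T i)) ->
    (forall i, (k <= i)%N -> (i < size T')%N -> s < arrival (nth dtask T' i)) ->
    forall i, (i < k)%N ->
      (forall u, u <= s -> sch_alloc (ALG T) i u = sch_alloc (ALG T') i u) /\
      ((exists u, u <= s /\ 0 < sch_alloc (ALG T) i u) ->
         sch_par (ALG T) i = sch_par (ALG T') i).

End SerialParallel.

(* Main.v *)
(** Up to a constant factor in speed the problem is total response time on
unrelated machines: give half of the processors to as many serial machines, and
fuse the other half into a single fast machine that runs parallel jobs.  On
arrival a task is dispatched to the machine on which inserting it increases the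
total completion time least, and every machine serves its tasks by shortest
remaining processing time; the chosen machine fixes the implementation.

The analysis follows the dual-fitting proof of Anand, Garg and Kumar.  The total
response time is at most the sum of the insertion prices.  Inserting a task of
length [s] at time [r] on a machine whose remaining lengths are [r_i] costs
[s + sum_i min (r_i, s)]: the shorter tasks delay the new one, and the new one
delays the longer ones.  At a later time [t] the machine has done at most [t - r]
of this, and every task still unfinished accounts for at most [s], so the price
is at most [(t - r) + s * (1 + number of tasks unfinished at t)].  Choosing the
machine according to the implementation used by the offline schedule, averaging
over the serial machines, and integrating against the processors that the
offline schedule gives to the task bounds the price by twice the offline
response time of the task plus a share of the online backlog.  Summed over all
tasks these shares amount to half of the online cost. *)
Require Import Defs.
From HB Require Import structures.
From mathcomp Require Import all_boot all_order all_algebra.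
From mathcomp Require Import all_classical all_reals all_analysis.
From mathcomp Require Import measurable_realfun ring lra zify.
Import Order.TTheory GRing.Theory Num.Theory.
Local Open Scope ring_scope.

(** * Shortest remaining processing time on a family of machines *)

Section Planning.
Set Implicit Arguments.
Unset Strict Implicit.
Unset Printing Implicit Defensive.
Variable R : realFieldType.
Implicit Types a b x y lo hi r s t : R.

(* The length of the part of the interval [a, b[ that lies after x. *)
Definition rest a b x : R := Num.max 0 (b - Num.max a x).

Lemma rest_ge0 a b x : 0 <= rest a b x.
Proof. by rewrite le_max lexx. Qed.

Lemma rest_done a b x : b <= x -> rest a b x = 0.
Proof. by move=> bx; apply/max_l; rewrite subr_le0 le_max bx orbT. Qed.

Lemma rest_alive a b x : a <= b -> x <= b -> rest a b x = b - Num.max a x.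
Proof. by move=> ab xb; apply/max_r; rewrite subr_ge0 ge_max ab. Qed.

Lemma rest_gt0 a b x : a < b -> (0 < rest a b x) = (x < b).
Proof. by move=> ab; rewrite lt_max ltxx subr_gt0 gt_max ab. Qed.

Lemma rest_const a b x y : x <= y -> b <= x \/ y <= a -> rest a b x = rest a b y.
Proof.
move=> xy [bx|ya]; first by rewrite !rest_done // (le_trans bx).
by rewrite /rest (max_l ya) (max_l (le_trans xy ya)).
Qed.

Lemma rest_le a b x y : x <= y -> rest a b y <= rest a b x.
Proof.
move=> xy; rewrite /rest ge_max le_max lexx /= le_max lerB ?orbT //.
by rewrite ge_max !le_max lexx xy orbT.
Qed.

Lemma rest_clamp a b lo hi : a < b -> lo < b -> a < hi -> lo <= hi ->
  rest a b lo - rest a b hi = Num.min b hi - Num.max a lo.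
Proof.
move=> ab lob ahi lohi; rewrite (@rest_alive a b lo) ?ltW //.
have [bhi|/ltW hib] := leP b hi; first by rewrite rest_done // subr0.
rewrite rest_alive ?(ltW ab) // (max_r (ltW ahi)); lra.
Qed.

(** A machine works off at most one unit of length per unit of time. By induction, with the window
    generalized: the last interval cuts out a middle part, and the hypothesis is applied to the
    windows on its left and right. *)
Lemma sum_rest_le n (J : pred nat) (a b : nat -> R) lo hi : lo <= hi ->
  (forall i j, (i < n)%N -> (j < n)%N -> J i -> J j -> i != j ->
     b i <= a j \/ b j <= a i) ->
  (forall i, (i < n)%N -> J i -> a i < b i) ->
  \sum_(i < n | J i) (rest (a i) (b i) lo - rest (a i) (b i) hi) <= hi - lo.
Proof.
elim: n lo hi => [|n IHn] lo hi lohi disj ltab; first by rewrite big_ord0 subr_ge0.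
have {}IHn lo' hi' : lo' <= hi' ->
    \sum_(i < n | J i) (rest (a i) (b i) lo' - rest (a i) (b i) hi') <= hi' - lo'.
  move=> h; apply: IHn => // i j *; [apply: disj|apply: ltab] => //; exact: ltnW.
rewrite big_mkcond big_ord_recr /= -big_mkcond /=.
case: ifP => [Jn|_]; last by rewrite addr0 IHn.
have ltn := ltab n (ltnSn n) Jn.
have [nlo|lon] := leP (b n) lo.
  by rewrite -(@rest_const _ _ lo hi) ?subrr ?addr0 ?IHn //; left.
have [hin|nhi] := leP hi (a n).
  by rewrite -(@rest_const _ _ lo hi) ?subrr ?addr0 ?IHn //; right.
(* The other intervals lie outside the window [x, y] cut out by the last one. *)
rewrite rest_clamp //; set x := Num.max _ _; set y := Num.min _ _.
have lox : lo <= x by rewrite le_max lexx orbT.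
have yhi : y <= hi by rewrite ge_min lexx orbT.
have xy : x <= y by rewrite ge_max !le_min (ltW ltn) (ltW nhi) (ltW lon).
have -> : \sum_(i < n | J i) (rest (a i) (b i) lo - rest (a i) (b i) hi) =
  \sum_(i < n | J i) (rest (a i) (b i) lo - rest (a i) (b i) x) +
  \sum_(i < n | J i) (rest (a i) (b i) y - rest (a i) (b i) hi).
  rewrite -big_split; apply: eq_bigr => i Ji /=.
  suff -> : rest (a i) (b i) x = rest (a i) (b i) y by rewrite addrA subrK.
  have [|in_|ni] := disj i n (ltnW (ltn_ord i)) (ltnSn n) Ji Jn.
  - by rewrite neq_ltn ltn_ord.
  - by apply: rest_const => //; left; rewrite le_max in_.
  - by apply: rest_const => //; right; rewrite ge_min ni.
have := lerD (IHn _ _ lox) (IHn _ _ yhi); lra.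
Qed.


(** A coerced boolean, so that planning needs only a [realFieldType]; [busy_indic] later turns it
    into a set indicator. *)
Definition busy a b x : R := ((a <= x < b)%R)%:R.

(** * Plans, their invariant and the insertion of a task *)

Section Insertion.
Variable M : eqType.

(* The schedule that is followed if no further task arrives: task [i] is processed
   at full speed on the intervals of [past i] and on [start i, finish i[, and only
   the latter may still be postponed by later arrivals. *)
Record plan := Plan {
  machine : nat -> M;
  past : nat -> seq (R * R);
  start : nat -> R;
  finish : nat -> R }.
Implicit Types (P : plan) (n i j k : nat) (m : M).

Definition rem P i x := rest (start P i) (finish P i) x.

Definition act P i x : R :=
  \sum_(I <- past P i) busy I.1 I.2 x + busy (start P i) (finish P i) x.

Definition service P i : R :=
  \sum_(I <- past P i) (I.2 - I.1) + (finish P i - start P i).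

Definition released P i a : Prop :=
  a <= start P i /\ forall I, I \in past P i -> a <= I.1.

(** The new task starts after every task with at most [s] left, ties included. Tasks already
    finished have nothing left and are also in the range, but they end by [r], the default of the
    maximum. *)
Definition slot P n m r s : R :=
  \big[Num.max/r]_(j < n | (machine P j == m) && (rem P j r <= s)) finish P j.

Definition displaced P n m r s i :=
  [&& (i < n)%N, machine P i == m & s < rem P i r].

(* A displaced task keeps the interval [start, r[ as past work; the interval
   recorded is empty when the task has not been started by time [r]. *)
Definition insert P n m r s : plan := Plan
  (fun i => if i == n then m else machine P i)
  (fun i => if i == n then [::]
            else if displaced P n m r s i
                 then (start P i, Num.max (start P i) r) :: past P i else past P i)
  (fun i => if i == n then slot P n m r s
            else if displaced P n m r s i then Num.max (start P i) r + s else start P i)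
  (fun i => if i == n then slot P n m r s + s
            else if displaced P n m r s i then finish P i + s else finish P i).

Definition marginal P n m r s : R :=
  s + \sum_(i < n | machine P i == m) Num.min (rem P i r) s.

(** Invariant of a plan for the first [n] tasks at the present time [b]. [srpt_packed] says that no
    machine idles between [b] and the end of an unfinished task. [srpt_past] allows empty pieces
    anywhere before [start]. *)
Record srpt P n b : Prop := Srpt {
  srpt_lt : forall i, (i < n)%N -> start P i < finish P i;
  srpt_disj : forall i j, (i < n)%N -> (j < n)%N -> machine P i = machine P j ->
    i != j -> finish P i <= start P j \/ finish P j <= start P i;
  srpt_sorted : forall i j, (i < n)%N -> (j < n)%N -> machine P i = machine P j ->
    b < finish P i -> finish P i <= start P j -> rem P i b <= rem P j b;
  srpt_packed : forall i, (i < n)%N -> b < finish P i ->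
    finish P i - b <=
    \sum_(j < n | (machine P j == machine P i) && (finish P j <= finish P i)) rem P j b;
  srpt_past : forall i I, (i < n)%N -> I \in past P i ->
    [/\ I.1 <= I.2, I.2 <= start P i & I.2 <= b \/ I.1 = I.2];
  srpt_capacity : forall m x, \sum_(i < n | machine P i == m) act P i x <= 1 }.

Lemma sum_rem_le P n b (J : pred nat) m lo hi : srpt P n b -> lo <= hi ->
  \sum_(i < n | (machine P i == m) && J i) (rem P i lo - rem P i hi) <= hi - lo.
Proof.
move=> wf lohi.
apply: (@sum_rest_le n (fun i => (machine P i == m) && J i)) => // [i j ltin ltjn|i ltin _].
  by move=> /andP[/eqP mi _] /andP[/eqP mj _]; apply: (srpt_disj wf); rewrite // mi mj.
exact: srpt_lt wf _ ltin.
Qed.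

(** Order: a task that has not started by [r] keeps its [rem], while the task before it can only
    shrink. Packing: the left side drops by exactly [r - b], the right side by at most that much. *)
Lemma srpt_advance P n b r : b <= r -> srpt P n b -> srpt P n r.
Proof.
move=> br wf; have [lt_ disj sorted packed past_ cap] := wf; split=> //.
- move=> i j ltin ltjn mij ri ij.
  apply: le_trans (rest_le _ _ br) _.
  rewrite /rem -(@rest_const _ _ b r) //; last by right; exact: le_trans (ltW ri) ij.
  by apply: sorted => //; exact: le_lt_trans br ri.
- move=> i ltin ri; have := packed i ltin (le_lt_trans br ri).
  have := sum_rem_le (fun j => finish P j <= finish P i) (machine P i) wf br.
  rewrite sumrB; lra.
- move=> i I ltin /(past_ _ _ ltin)[-> -> [Ib|->]]; split=> //; last by right.
  by left; exact: le_trans br.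
Qed.

(** Termwise, a task finished by [t] is charged to the drop of its [rem] on [[r, t]], and an
    unfinished one to that drop plus [s]; the drops sum to at most [t - r]. The freedom in [t] is
    what later allows averaging over time. *)
Lemma marginal_le P n b m r s t : srpt P n b -> r <= t -> 0 <= s ->
  marginal P n m r s <=
  (t - r) + s * (1 + \sum_(i < n | machine P i == m) ((t < finish P i)%R)%:R).
Proof.
move=> wf rt s0; have := sum_rem_le (fun=> true) m wf rt.
rewrite (eq_bigl (fun i : 'I_n => machine P i == m)) => [|i]; last by rewrite andbT.
rewrite mulrDr mulr1 mulr_sumr /marginal (addrCA (t - r)) lerD2l => h.
apply: le_trans (lerD h (lexx _)).
rewrite -big_split; apply: ler_sum => i _ /=.
have [tf|ft] := ltP t (finish P i).
  by rewrite mulr1 ge_min lerDr subr_ge0 rest_le ?orbT.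
by rewrite mulr0 addr0 [rem P i t]rest_done // subr0 ge_min lexx.
Qed.

Lemma ltnS_eqVlt i n : (i < n.+1)%N = (i == n) || (i < n)%N.
Proof. by rewrite ltnS leq_eqVlt. Qed.

(** * Insertion preserves the invariant and costs at most the marginal price *)

Section InsertStep.
Variables (P : plan) (n : nat) (m : M) (r s : R).
Hypotheses (wf : srpt P n r) (s_gt0 : 0 < s).
Local Notation P' := (insert P n m r s).
Let big i := displaced P n m r s i.

Ltac lra_s := have := s_gt0; lra.

Lemma slot_ge : r <= slot P n m r s.
Proof. exact: bigmax_ge_id. Qed.

Lemma slot_ge_small j : (j < n)%N -> machine P j = m -> ~~ big j ->
  finish P j <= slot P n m r s.
Proof.
move=> ltjn mj; rewrite /big /displaced ltjn mj eqxx -leNgt => rj.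
by apply: (le_bigmax_cond _ (fun j : 'I_n => finish P j) (j := Ordinal ltjn)); rewrite mj eqxx.
Qed.

Lemma displaced_alive i : big i -> r < finish P i /\
  rem P i r = finish P i - Num.max (start P i) r.
Proof.
case/and3P => ltin _ sr; have ltsf := srpt_lt wf ltin.
have rf : r < finish P i by rewrite -(rest_gt0 _ ltsf) (lt_trans s_gt0).
by split=> //; rewrite /rem rest_alive // ltW.
Qed.

(** In the opposite order [srpt_sorted] would give the displaced task no more remaining length than
    the small one, hence at most [s]. *)
Lemma small_before_displaced i j : (j < n)%N -> machine P j = m -> ~~ big j ->
  big i -> r < finish P j -> finish P j <= start P i.
Proof.
move=> ltjn mj nbj bi rj; have /and3P[ltin /eqP mi sri] := bi.
have ji : j != i by apply: contraNneq nbj => ->.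
have [//|ij] := srpt_disj wf ltjn ltin (etrans mj (esym mi)) ji.
have [rf _] := displaced_alive bi.
have := srpt_sorted wf ltin ltjn (etrans mi (esym mj)) rf ij.
move: nbj; rewrite /big /displaced ltjn mj eqxx -leNgt => rjs rij.
by have := le_lt_trans (le_trans rij rjs) sri; rewrite ltxx.
Qed.

Lemma slot_le_displaced i : big i -> slot P n m r s <= Num.max (start P i) r.
Proof.
move=> bi; apply/bigmax_leP; split=> [|j /andP[/eqP mj rj]].
  by rewrite le_max lexx orbT.
have nbj : ~~ big j by rewrite /big /displaced ltn_ord mj eqxx -leNgt.
have [rf|fr] := ltP r (finish P j); last by rewrite le_max fr orbT.
by rewrite le_max (small_before_displaced _ mj nbj bi).
Qed.


Lemma machine_insert i : (i < n)%N -> machine P' i = machine P i.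
Proof. by move=> ltin; rewrite /insert /= (ltn_eqF ltin). Qed.

Lemma start_insert i : (i < n)%N ->
  start P' i = if big i then Num.max (start P i) r + s else start P i.
Proof. by move=> ltin; rewrite /insert /= (ltn_eqF ltin). Qed.

Lemma finish_insert i : (i < n)%N ->
  finish P' i = if big i then finish P i + s else finish P i.
Proof. by move=> ltin; rewrite /insert /= (ltn_eqF ltin). Qed.

Lemma past_insert i : (i < n)%N ->
  past P' i = if big i then (start P i, Num.max (start P i) r) :: past P i else past P i.
Proof. by move=> ltin; rewrite /insert /= (ltn_eqF ltin). Qed.

Lemma machine_insert_new : machine P' n = m.
Proof. by rewrite /insert /= eqxx. Qed.

Lemma start_insert_new : start P' n = slot P n m r s.
Proof. by rewrite /insert /= eqxx. Qed.

Lemma finish_insert_new : finish P' n = slot P n m r s + s.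
Proof. by rewrite /insert /= eqxx. Qed.

Lemma past_insert_new : past P' n = [::].
Proof. by rewrite /insert /= eqxx. Qed.

Opaque insert.

Lemma finish_insert_ge i : (i < n)%N -> finish P i <= finish P' i <= finish P i + s.
Proof.
move=> ltin; rewrite finish_insert //; case: ifP => _.
  by rewrite lexx lerDl ltW.
by rewrite lexx lerDl ltW.
Qed.

(** The part of a displaced task that lies after [r] is translated by [s], so its length is kept. *)
Lemma rem_insert i : (i < n)%N -> rem P' i r = rem P i r.
Proof.
move=> ltin; rewrite {1}/rem start_insert // finish_insert //; case: ifP => // bi.
have [rf ->] := displaced_alive bi.
have maxr : r <= Num.max (start P i) r by rewrite le_max lexx orbT.
have maxf : Num.max (start P i) r <= finish P i.
  by rewrite ge_max (ltW rf) ltW // (srpt_lt wf).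
rewrite rest_alive; [|by rewrite lerD2r|by lra_s].
by rewrite [Num.max (_ + s) r]max_l; lra_s.
Qed.

Lemma rem_insert_new : rem P' n r = s.
Proof.
rewrite /rem start_insert_new finish_insert_new; have := slot_ge => h.
by rewrite rest_alive ?max_l; lra_s.
Qed.

Lemma big_machine i : big i -> machine P i = m.
Proof. by case/and3P => _ /eqP. Qed.

Lemma rem_small i : (i < n)%N -> machine P i = m -> ~~ big i -> rem P i r <= s.
Proof. by move=> ltin mi; rewrite /big /displaced ltin mi eqxx -leNgt. Qed.

Lemma small_le_small i j : (i < n)%N -> (j < n)%N -> machine P i = machine P j ->
  ~~ big i -> r < finish P i -> finish P j <= finish P i -> ~~ big j.
Proof.
move=> ltin ltjn mij si ri ji; apply/negP => bj.
have := small_before_displaced ltin (etrans mij (big_machine bj)) si bj ri.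
by move=> /(le_trans ji); rewrite leNgt (srpt_lt wf).
Qed.

(** Apply [srpt_packed] to each unfinished small task: by [small_le_small] all tasks that end no
    later are small too. *)
Lemma slot_packed :
  slot P n m r s - r <= \sum_(j < n | (machine P j == m) && ~~ big j) rem P j r.
Proof.
rewrite lerBlDr; apply/bigmax_leP; split=> [|i /andP[/eqP mi ri]].
  by rewrite lerDr sumr_ge0 // => j _; exact: rest_ge0.
have si : ~~ big i by rewrite /big /displaced ltn_ord mi eqxx -leNgt.
have [rf|fr] := ltP r (finish P i); last first.
  by rewrite (le_trans fr) // lerDr sumr_ge0 // => j _; exact: rest_ge0.
rewrite -lerBlDr; apply: le_trans (srpt_packed wf (ltn_ord i) rf) _.
rewrite [leLHS]big_mkcond [leRHS]big_mkcond; apply: ler_sum => j _ /=.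
case: ifP => [/andP[/eqP mj ji]|_]; last by case: ifP => // _; exact: rest_ge0.
by rewrite mj mi eqxx (small_le_small (ltn_ord i) (ltn_ord j) (esym mj) si rf ji).
Qed.

(** Each displaced task is delayed by [s], and the new one ends at [slot + s], where [slot_packed]
    bounds the wait. These are the two branches of the minimum in [marginal]. *)
Lemma insert_cost :
  \sum_(i < n.+1) finish P' i <=
  \sum_(i < n) finish P i + r + marginal P n m r s.
Proof.
rewrite big_ord_recr finish_insert_new /= /marginal.
have -> : \sum_(i < n) finish P' i =
    \sum_(i < n) finish P i + \sum_(i < n | (machine P i == m) && big i) s.
  rewrite [X in _ + X]big_mkcond -big_split; apply: eq_bigr => i _ /=.
  rewrite finish_insert //; case: ifP => bi; last by rewrite andbF addr0.
  by rewrite andbT (big_machine bi) eqxx.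
have -> : \sum_(i < n | machine P i == m) Num.min (rem P i r) s =
    \sum_(i < n | (machine P i == m) && big i) s +
    \sum_(i < n | (machine P i == m) && ~~ big i) rem P i r.
  rewrite (bigID (fun i : 'I_n => big i)) /=; congr (_ + _); apply: eq_bigr => i.
    by move=> /andP[_ /and3P[_ _ /ltW]] /min_r.
  by move=> /andP[/eqP mi /(rem_small (ltn_ord i) mi)] /min_l.
have := slot_packed; lra_s.
Qed.

(** The piece moved to [past] and the shifted remainder add up to the old interval. *)
Lemma service_insert i : (i < n)%N -> service P' i = service P i.
Proof.
move=> ltin; rewrite /service past_insert // start_insert // finish_insert //.
by case: ifP => // bi; rewrite big_cons /=; lra.
Qed.

Lemma service_insert_new : service P' n = s.
Proof. by rewrite /service past_insert_new start_insert_new finish_insert_new big_nil; lra. Qed.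

Lemma released_insert i a : (i < n)%N -> released P i a -> released P' i a.
Proof.
move=> ltin [ast apast]; split; rewrite ?past_insert ?start_insert //; case: ifP => // _.
  have : start P i <= Num.max (start P i) r by rewrite le_max lexx.
  lra_s.
by move=> I; rewrite inE => /orP[/eqP->//|/apast].
Qed.

Lemma released_insert_new : released P' n r.
Proof. by split; rewrite ?past_insert_new ?start_insert_new // slot_ge. Qed.

Lemma insert_lt i : (i < n.+1)%N -> start P' i < finish P' i.
Proof.
rewrite ltnS_eqVlt => /orP[/eqP->|ltin].
  by rewrite start_insert_new finish_insert_new ltrDl.
rewrite start_insert // finish_insert //; have := srpt_lt wf ltin.
by case: ifP => // /displaced_alive[rf _] sf; rewrite ltrD2r gt_max sf.
Qed.

Lemma insert_disj_new j : (j < n)%N -> machine P j = m ->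
  finish P' n <= start P' j \/ finish P' j <= start P' n.
Proof.
move=> ltjn mj; rewrite finish_insert_new start_insert_new start_insert // finish_insert //.
case: ifPn => bj; first by left; rewrite lerD2r slot_le_displaced.
by right; exact: slot_ge_small.
Qed.

Lemma insert_disj_mixed i j : (j < n)%N -> machine P j = m ->
  big i -> ~~ big j -> finish P j <= Num.max (start P i) r + s.
Proof.
move=> ltjn mj bi sj; have [rf|fr] := ltP r (finish P j).
  have := small_before_displaced ltjn mj sj bi rf.
  have : start P i <= Num.max (start P i) r by rewrite le_max lexx.
  lra_s.
have : r <= Num.max (start P i) r by rewrite le_max lexx orbT.
lra_s.
Qed.

Lemma insert_disj i j : (i < n.+1)%N -> (j < n.+1)%N -> machine P' i = machine P' j ->
  i != j -> finish P' i <= start P' j \/ finish P' j <= start P' i.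
Proof.
rewrite !ltnS_eqVlt => /orP[/eqP->|ltin] /orP[/eqP->|ltjn].
- by rewrite eqxx.
- by rewrite machine_insert_new machine_insert // => mj _; apply: insert_disj_new.
- rewrite machine_insert_new machine_insert // => mi _.
  by case: (insert_disj_new ltin mi); [right|left].
rewrite !machine_insert // !start_insert // !finish_insert // => mij ij.
have := srpt_disj wf ltin ltjn mij ij.
case: ifPn => bi; case: ifPn => bj //.
- rewrite !lerD2r => -[] h; [left|right]; by rewrite le_max h.
- by right; apply: insert_disj_mixed => //; rewrite -mij big_machine.
- by left; apply: insert_disj_mixed => //; rewrite mij big_machine.
Qed.

Lemma insert_sorted i j : (i < n.+1)%N -> (j < n.+1)%N -> machine P' i = machine P' j ->
  r < finish P' i -> finish P' i <= start P' j -> rem P' i r <= rem P' j r.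
Proof.
rewrite !ltnS_eqVlt => /orP[/eqP->|ltin] /orP[/eqP->|ltjn].
- by [].
- rewrite machine_insert_new machine_insert // rem_insert_new rem_insert // => mj _.
  rewrite finish_insert_new start_insert //; case: ifPn => [/and3P[_ _ /ltW]//|bj].
  have := slot_ge_small ltjn (esym mj) bj; have := srpt_lt wf ltjn; lra_s.
- rewrite machine_insert_new machine_insert // rem_insert_new rem_insert // => mi _.
  rewrite start_insert_new finish_insert //; case: ifPn => [bi|bi _]; last exact: rem_small.
  have := slot_le_displaced bi; have [rf _] := displaced_alive bi.
  have : Num.max (start P i) r < finish P i by rewrite gt_max rf (srpt_lt wf).
  lra_s.
rewrite !machine_insert // !start_insert // !finish_insert // !rem_insert // => mij.
case: ifPn => bi; case: ifPn => bj ri.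
- have [rf _] := displaced_alive bi; rewrite lerD2r le_max [finish P i <= r]leNgt rf orbF.
  exact: (srpt_sorted wf).
- have [rf _] := displaced_alive bi; move=> h; apply: (srpt_sorted wf) => //; lra_s.
(* A small task precedes a displaced one: the threshold [s] separates their remaining lengths. *)
- move=> _; apply: le_trans (rem_small ltin _ bi) _; first by rewrite mij big_machine.
  by case/and3P: bj => _ _ /ltW.
- exact: (srpt_sorted wf).
Qed.

(** The new task waits only for small tasks. A displaced task gains [s] on both sides, since the new
    task enters its sum. The tasks that end no later than an unfinished small one are small, hence
    unmoved. *)
Lemma insert_packed i : (i < n.+1)%N -> r < finish P' i ->
  finish P' i - r <=
  \sum_(j < n.+1 | (machine P' j == machine P' i) && (finish P' j <= finish P' i)) rem P' j r.
Proof.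
rewrite ltnS_eqVlt => /orP[/eqP->|ltin] ri;
  rewrite big_mkcond big_ord_recr /= -big_mkcond.
  rewrite machine_insert_new finish_insert_new eqxx lexx /= rem_insert_new.
  rewrite addrAC lerD2r; apply: le_trans slot_packed _.
  rewrite [leLHS]big_mkcond [leRHS]big_mkcond; apply: ler_sum => j _ /=.
  rewrite machine_insert // finish_insert // rem_insert //.
  case: ifP => [/andP[/eqP mj bj]|_]; last by case: ifP => // _; exact: rest_ge0.
  rewrite mj eqxx (negbTE bj) ifT //=.
  by have := slot_ge_small (ltn_ord j) mj bj; lra_s.
rewrite machine_insert // machine_insert_new rem_insert_new.
move: ri; rewrite !(finish_insert ltin) finish_insert_new; case: ifPn => [bi|si] ri.
  have [rf _] := displaced_alive bi.
  have maxf : Num.max (start P i) r <= finish P i.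
    by rewrite ge_max (ltW rf) ltW // (srpt_lt wf).
  rewrite (big_machine bi) eqxx lerD2r (le_trans (slot_le_displaced bi)) //=.
  rewrite addrAC lerD2r; apply: le_trans (srpt_packed wf ltin rf) _.
  rewrite [leLHS]big_mkcond [leRHS]big_mkcond; apply: ler_sum => j _ /=.
  rewrite machine_insert // rem_insert // (big_machine bi).
  case: ifP => [/andP[/eqP mj ji]|_]; last by case: ifP => // _; exact: rest_ge0.
  rewrite mj eqxx ifT //=; have /andP[_ h] := finish_insert_ge (ltn_ord j).
  by apply: le_trans h _; rewrite lerD2r.
apply: le_trans (srpt_packed wf ltin ri) _; rewrite -[leLHS]addr0; apply: lerD; last first.
  by case: ifP => // _; exact: ltW.
rewrite [leLHS]big_mkcond [leRHS]big_mkcond; apply: ler_sum => j _ /=.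
rewrite machine_insert // rem_insert // finish_insert //.
case: ifP => [/andP[/eqP mj ji]|_]; last by case: ifP => // _; exact: rest_ge0.
by rewrite mj eqxx (negbTE (small_le_small ltin (ltn_ord j) (esym mj) si ri ji)) ji.
Qed.

Lemma insert_past i I : (i < n.+1)%N -> I \in past P' i ->
  [/\ I.1 <= I.2, I.2 <= start P' i & I.2 <= r \/ I.1 = I.2].
Proof.
rewrite ltnS_eqVlt => /orP[/eqP->|ltin]; first by rewrite past_insert_new.
rewrite past_insert // start_insert //; case: ifPn => bi; last exact: srpt_past wf _ _ ltin.
rewrite inE => /orP[/eqP->|/(srpt_past wf ltin)[I12 Is Ir]] /=.
  split; [by rewrite le_max lexx|by rewrite lerDl ltW|].
  by case: (leP (start P i) r) => _; [left|right].
split=> //; apply: le_trans Is _.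
have : start P i <= Num.max (start P i) r by rewrite le_max lexx.
lra_s.
Qed.

(** Before [r] the recorded piece coincides with the interval it was cut from. This is the source of
    the online property. *)
Lemma act_insert_before i x : (i < n)%N -> x < r -> act P' i x = act P i x.
Proof.
move=> ltin xr; rewrite /act past_insert // start_insert // finish_insert //.
case: ifPn => // /displaced_alive[rf _]; rewrite big_cons /= addrAC addrC; congr (_ + _).
have rmax : r <= Num.max (start P i) r by rewrite le_max lexx orbT.
rewrite /busy (lt_trans xr rf) (lt_le_trans xr rmax).
by rewrite [X in X && (x < finish P i + s)]leNgt (_ : x < Num.max (start P i) r + s) /= ?addr0 //; lra_s.
Qed.

Lemma act_insert_new x : x < r -> act P' n x = 0.
Proof.
move=> xr; rewrite /act past_insert_new start_insert_new big_nil add0r /busy leNgt.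
by rewrite (lt_le_trans xr slot_ge).
Qed.

(** From [r] on all past pieces are over or empty, and by disjointness at most one current interval
    contains [x]. Before [r] nothing has changed and the new task is idle. *)
Lemma insert_capacity m' x : \sum_(i < n.+1 | machine P' i == m') act P' i x <= 1.
Proof.
have [rx|xr] := leP r x.
  have actE i : (i < n.+1)%N -> act P' i x = busy (start P' i) (finish P' i) x.
    move=> ltin; rewrite /act big_seq big1 ?add0r // => I /(insert_past ltin)[I12 _ Ir].
    rewrite /busy; case: Ir => [Ir|->]; last by rewrite ltNge andbN.
    by rewrite [x < _]ltNge (le_trans Ir rx) andbF.
  pose running (i : 'I_n.+1) := (machine P' i == m') && (start P' i <= x < finish P' i).
  have [i /andP[mi xi]|none] := pickP running; last first.
    rewrite big1 // => i mi; rewrite actE // /busy.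
    by have := none i; rewrite /running mi /= => ->.
  rewrite (bigD1 i) //= big1 ?addr0; last first.
    move=> j /andP[mj ji]; rewrite actE // /busy.
    have := insert_disj (ltn_ord i) (ltn_ord j) (etrans (eqP mi) (esym (eqP mj))).
    rewrite eq_sym => /(_ ji); case/andP: xi => si fi [] h.
      by rewrite leNgt (lt_le_trans fi h).
    by rewrite [x < _]ltNge (le_trans h si) andbF.
  by rewrite actE // /busy; case: (_ && _); rewrite ?lexx ?ler01.
rewrite big_mkcond big_ord_recr /= -big_mkcond act_insert_new // if_same addr0.
apply: le_trans (srpt_capacity wf m' x).
rewrite [leLHS]big_mkcond [leRHS]big_mkcond; apply: ler_sum => i _ /=.
by rewrite machine_insert // act_insert_before.
Qed.

Lemma srpt_insert : srpt P' n.+1 r.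
Proof.
split; [exact: insert_lt|exact: insert_disj|exact: insert_sorted|exact: insert_packed| |].
- exact: insert_past.
- exact: insert_capacity.
Qed.

End InsertStep.
End Insertion.
End Planning.

(** * Integrals of allocations *)

Section Measure.
Set Implicit Arguments.
Unset Strict Implicit.
Unset Printing Implicit Defensive.
Local Open Scope classical_set_scope.
Variable R : realType.
Implicit Types (a b s : R) (P : plan R nat).
Notation mu := (@lebesgue_measure R).

Lemma busy_indic a b : busy a b = \1_(`[a, b[) :> (R -> R).
Proof. by apply/funext => x; rewrite /busy indicE mem_setE in_itv. Qed.

Lemma measurable_busy a b : measurable_fun setT (busy a b).
Proof. by rewrite busy_indic; exact: measurable_indic. Qed.

Lemma busy_ge0 a b x : 0 <= busy a b x.
Proof. by rewrite /busy ler0n. Qed.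

Lemma measurable_ray s : measurable [set x : R | (x <= s)%R].
Proof. by rewrite -set_itvNyc. Qed.

Lemma integral_busy_ray a b s : a <= b ->
  (\int[mu]_(x in [set x : R | (x <= s)%R]) (busy a b x)%:E)%E = (b - a - rest a b s)%:E.
Proof.
move=> ab; rewrite busy_indic integral_indic //; [|exact: measurable_ray].
have [bs|sb] := leP b s.
  rewrite rest_done // subr0 setIidl => [|x /=]; last first.
    by rewrite in_itv /= => /andP[_ /ltW xb]; exact: le_trans bs.
  by rewrite /= lebesgue_measure_itv/= lte_fin -EFinD; case: ltgtP ab => // ->; rewrite subrr.
have [as_|sa] := leP a s.
  rewrite rest_alive ?(ltW sb) // max_r // (_ : _ `&` _ = `[a, s]%classic).
    rewrite /= lebesgue_measure_itv/= lte_fin -EFinD; case: ltgtP as_ => // [_ _|-> _].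
      by congr (_%:E); lra.
    by congr (_%:E); lra.
  apply/seteqP; split=> x /=; rewrite !in_itv /=; first by case=> /andP[-> _] ->.
  by move=> /andP[-> xs]; split=> //; exact: le_lt_trans sb.
rewrite rest_alive ?(ltW sb) // max_l ?(ltW sa) // subrr (_ : _ `&` _ = set0) ?measure0 //.
apply/seteqP; split=> x //=; rewrite in_itv /= => -[/andP[ax _]].
by move=> /(le_trans ax); rewrite leNgt sa.
Qed.

Lemma integral_indicM (y : R -> R) (E : set R) :
  (\int[mu]_(x in E) (y x)%:E)%E = (\int[mu]_x (y x * \1_E x)%:E)%E.
Proof.
rewrite integral_mkcond; apply: eq_integral => x _.
by rewrite patchE indicE; case: (x \in E); rewrite ?mulr1 ?mulr0.
Qed.

(** Averaging with weight [y]: the bound on [alpha] is multiplied by [y x], so it has content only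
    at times where [y] is nonzero, and is then integrated. *)
Lemma weighted_bound (y : R -> R) (w alpha A g : R) n (E : 'I_n -> set R) :
  measurable_fun setT y -> (forall x, 0 <= y x) -> (\int[mu]_x (y x)%:E)%E = w%:E ->
  0 <= alpha -> 0 <= A -> 0 <= g -> (forall i, measurable (E i)) ->
  (forall x, y x * alpha <= y x * (A + g * \sum_(i < n) \1_(E i) x)) ->
  w * alpha <= w * A + g * \sum_(i < n) fine (\int[mu]_(x in E i) (y x)%:E)%E.
Proof.
move=> my y0 yw alpha0 A0 g0 mE le_y.
have y0e x : (0 <= (y x)%:E)%E by rewrite lee_fin.
have mEy : measurable_fun setT (EFin \o y) by exact/measurable_EFinP.
have mi i : measurable_fun setT (fun x => y x * \1_(E i) x).
  by apply: measurable_funM => //; exact: measurable_indic.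
have i0 i x : 0 <= y x * \1_(E i) x by rewrite mulr_ge0 // indicE.
(* Each integral is at most the total [w], so [fine] loses nothing. *)
have fin_y i : (\int[mu]_(x in E i) (y x)%:E)%E \is a fin_num.
  rewrite ge0_fin_numE ?integral_ge0 //.
  apply: (@le_lt_trans _ _ w%:E); last exact: ltry.
  by rewrite -yw; apply: ge0_subset_integral => //; exact: mE.
have ms : measurable_fun setT (fun x => \sum_(i < n) (y x * \1_(E i) x)).
  exact: measurable_sum.
have s0 x : 0 <= \sum_(i < n) (y x * \1_(E i) x) by apply: sumr_ge0.
have split_sum : (\int[mu]_x (\sum_(i < n) (y x * \1_(E i) x))%:E)%E =
    (\sum_(i < n) fine (\int[mu]_(x in E i) (y x)%:E)%E)%:E.
  under eq_integral do rewrite -sumEFin.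
  rewrite ge0_integral_sum // => [|j|j x _]; last 2 first.
  - by apply/measurable_EFinP; exact: mi.
  - by rewrite lee_fin.
  rewrite -sumEFin; apply: eq_bigr => i _.
  by rewrite fineK // integral_indicM.
rewrite -lee_fin EFinD !EFinM -yw -split_sum [(g%:E * _)%E]muleC.
rewrite -!ge0_integralZr //=; first last.
- by move=> x _; rewrite lee_fin; exact: s0.
- by apply/measurable_EFinP; exact: ms.
rewrite -ge0_integralD //=; first last.
- by apply/measurable_EFinP; apply: measurable_funM.
- by move=> x _; rewrite lee_fin mulr_ge0.
- by apply/measurable_EFinP; apply: measurable_funM.
- by move=> x _; rewrite lee_fin mulr_ge0.
apply: ge0_le_integral => //= [x _|||x _].
- by rewrite lee_fin mulr_ge0.
- by apply/measurable_EFinP; apply: measurable_funM.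
- by apply/measurable_EFinP; apply: measurable_funD; apply: measurable_funM.
rewrite lee_fin; apply: le_trans (le_y x) _.
by rewrite mulrDr lerD2l mulrCA -mulr_sumr mulrC.
Qed.

End Measure.

(** * Greedy dispatch *)

Section Greedy.
Set Implicit Arguments.
Unset Strict Implicit.
Unset Printing Implicit Defensive.
Local Open Scope classical_set_scope.
Variable R : realType.
Notation leb := (@lebesgue_measure R).

(** * Work received by a task under a plan *)

Section Service.
Variable M : eqType.
Implicit Types (P : plan R M) (i n : nat).

Lemma measurable_act P i : measurable_fun setT (act P i).
Proof.
apply: measurable_funD; last exact: measurable_busy.
by apply: measurable_sum => I; exact: measurable_busy.
Qed.

Lemma act_ge0 P i x : 0 <= act P i x.
Proof. by rewrite addr_ge0 ?sumr_ge0 ?busy_ge0 // => I _; exact: busy_ge0. Qed.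

Lemma act_le1 P n b i x : srpt P n b -> (i < n)%N -> act P i x <= 1.
Proof.
move=> wf ltin; apply: le_trans (srpt_capacity wf (machine P i) x).
rewrite (bigD1 (Ordinal ltin)) //= lerDl sumr_ge0 // => j _; exact: act_ge0.
Qed.

Lemma act_released P i a x : start P i <= finish P i ->
  released P i a -> x < a -> act P i x = 0.
Proof.
move=> sf [sa pa] xa; rewrite /act /busy leNgt (lt_le_trans xa sa) addr0.
by rewrite big_seq big1 // => I /pa aI; rewrite leNgt (lt_le_trans xa aI).
Qed.

Lemma act_finished P n b i x : srpt P n b -> (i < n)%N -> finish P i < x -> act P i x = 0.
Proof.
move=> wf ltin fx; rewrite /act /busy ![x < _]ltNge (ltW fx) andbF addr0.
rewrite big_seq big1 // => I /(srpt_past wf ltin)[_ Is _].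
by rewrite [x < _]ltNge (le_trans Is) ?andbF // (le_trans _ (ltW fx)) // ltW // (srpt_lt wf).
Qed.

Lemma integral_act P n b i v s : srpt P n b -> (i < n)%N -> 0 <= v ->
  (\int[leb]_(x in [set x : R | (x <= s)%R]) (v * act P i x)%:E)%E =
  (v * (service P i - (\sum_(I <- past P i) rest I.1 I.2 s + rem P i s)))%:E.
Proof.
move=> wf ltin v0; have mray := @measurable_ray R s.
have mb a c : measurable_fun [set x : R | (x <= s)%R] (fun x => (busy a c x)%:E).
  by apply/measurable_EFinP; apply: measurable_funTS; exact: measurable_busy.
have b0 a c (x : R) : (0 <= (busy a c x)%:E :> \bar R)%E by rewrite lee_fin busy_ge0.
under eq_integral do rewrite EFinM.
rewrite ge0_integralZl_EFin //; last 2 first.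
- by move=> x _; rewrite lee_fin act_ge0.
- by apply/measurable_EFinP; apply: measurable_funTS; exact: measurable_act.
rewrite EFinM; congr (_ * _)%E.
under eq_integral do rewrite EFinD -sumEFin.
rewrite ge0_integralD //; [|by move=> x _; apply: sume_ge0| |exact: mb].
  2: by apply: emeasurable_sum => I; exact: mb.
rewrite ge0_integral_sum //; last by move=> I; exact: mb.
rewrite integral_busy_ray ?ltW ?(srpt_lt wf) //.
rewrite big_seq (eq_bigr (fun I => (I.2 - I.1 - rest I.1 I.2 s)%:E)); last first.
  by move=> I /(srpt_past wf ltin)[I12 _ _]; rewrite integral_busy_ray.
rewrite -big_seq sumEFin -EFinD sumrB /service /rem; congr (_%:E); lra.
Qed.

End Service.

(** * The dispatching scheduler, its online property and its feasibility *)

Section Dispatch.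
Variable p : nat.
Implicit Types (T : TAP R) (tau : task R) (mu : 'I_(p./2).+1) (P : plan R 'I_(p./2).+1).
Implicit Types (i k n : nat) (s t b : R).

(* Machine [ord0] is the fast one; the others are single processors. *)
Definition speed mu : R := if mu == ord0 then (p - p./2)%:R else 1.

Definition duration tau mu : R :=
  if mu == ord0 then par_work tau / (p - p./2)%:R else serial_work tau.

Definition quote P n tau mu := marginal P n mu (arrival tau) (duration tau mu).

Definition dispatch P n tau := [arg min_(mu < ord0) quote P n tau mu]%O.

Definition enqueue P n tau :=
  let mu := dispatch P n tau in insert P n mu (arrival tau) (duration tau mu).

(** The values of the initial plan are placeholders: for zero tasks [srpt] constrains none of
    them. *)
Fixpoint plan_upto T n : plan R 'I_(p./2).+1 :=
  if n is k.+1 then enqueue (plan_upto T k) k (nth (dtask R) T k)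
  else Plan (fun=> ord0) (fun=> [::]) (fun=> 0) (fun=> 0).

Lemma plan_uptoS T n (P := plan_upto T n) (tau := nth (dtask R) T n) :
  plan_upto T n.+1 =
  insert P n (dispatch P n tau) (arrival tau) (duration tau (dispatch P n tau)).
Proof. by []. Qed.

Definition greedy T : schedule R :=
  let P := plan_upto T (size T) in
  Schedule (fun i => machine P i == ord0)
           (fun i x => speed (machine P i) * act P i x)
           (finish P).

Lemma plan_upto_take T T' k : (k <= size T)%N -> (k <= size T')%N ->
  take k T = take k T' -> plan_upto T k = plan_upto T' k.
Proof.
elim: k => // k IHk kT kT' eqT /=.
have nthE : nth (dtask R) T k = nth (dtask R) T' k.
  by rewrite -[LHS](nth_take _ (ltnSn k)) eqT nth_take.
rewrite nthE IHk ?(ltnW kT) ?(ltnW kT') //.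
by have := congr1 (take k) eqT; rewrite !take_takel.
Qed.

Hypothesis p_ge2 : (2 <= p)%N.

Lemma speed_fast_gt0 : 0 < (p - p./2)%:R :> R.
Proof. by rewrite ltr0n subn_gt0 ltn_half_double -addnn -[ltnLHS]addn0 ltn_add2l; case: (p) p_ge2. Qed.

Lemma speed_gt0 mu : 0 < speed mu.
Proof. by rewrite /speed; case: ifP => _; rewrite ?ltr01 ?speed_fast_gt0. Qed.

Lemma duration_gt0 tau mu : valid_task p tau -> 0 < duration tau mu.
Proof.
case=> s0 sp _ _; rewrite /duration; case: ifP => // _.
by rewrite divr_gt0 ?speed_fast_gt0 // (lt_le_trans s0).
Qed.

Lemma speed_duration tau mu : speed mu * duration tau mu = work tau (mu == ord0).
Proof.
rewrite /speed /duration /work; case: ifP => _; last by rewrite mul1r.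
by rewrite mulrC divfK // gt_eqF ?speed_fast_gt0.
Qed.

Lemma sum_speed : \sum_mu speed mu = p%:R.
Proof.
rewrite big_ord_recl /= {1}/speed eqxx (eq_bigr (fun=> 1)) => [|i _]; last by [].
rewrite sumr_const card_ord -mulr_natr mul1r -natrD subnK //.
by rewrite -[leqRHS]odd_double_half -addnn addnA leq_addl.
Qed.

Lemma dispatch_le P n tau mu :
  quote P n tau (dispatch P n tau) <= quote P n tau mu.
Proof. by rewrite /dispatch; case: Order.TotalTheory.arg_minP => // i _ /(_ mu isT). Qed.

Section Run.
Variable T : TAP R.
Hypothesis Tvalid : valid_tap p T.
Let tau i := nth (dtask R) T i.

Lemma srpt_upto n b : (n <= size T)%N -> (forall i, (i < n)%N -> arrival (tau i) <= b) ->
  srpt (plan_upto T n) n b.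
Proof.
elim: n b => [|n IHn] b nT arr_b.
  by split=> // mu x; rewrite big_ord0.
apply: srpt_advance (arr_b n (ltnSn n)) _; apply: srpt_insert.
  apply: IHn => [|i ltin]; first exact: ltnW.
  by apply: Tvalid.2; rewrite ?(ltnW ltin).
by apply: duration_gt0; apply: Tvalid.1.
Qed.

Lemma srpt_upto_arrival n : (n < size T)%N -> srpt (plan_upto T n) n (arrival (tau n)).
Proof.
move=> nT; apply: srpt_upto => [|i ltin]; first exact: ltnW.
by apply: Tvalid.2; rewrite ?(ltnW ltin).
Qed.

(** Tasks never migrate, so the implementation is fixed at arrival. *)
Lemma machine_upto i k n : (i < k)%N -> (k <= n)%N ->
  machine (plan_upto T n) i = machine (plan_upto T k) i.
Proof.
move=> ltik; elim: n => [|n IHn]; first by rewrite leqn0 => /eqP->.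
rewrite leq_eqVlt => /orP[/eqP-> //|]; rewrite ltnS => kn.
by rewrite plan_uptoS machine_insert ?IHn // (leq_trans ltik).
Qed.

Lemma act_upto i k n s u : (i < k)%N -> (k <= n)%N -> (n <= size T)%N ->
  (forall j, (k <= j)%N -> (j < n)%N -> s < arrival (tau j)) -> u <= s ->
  act (plan_upto T n) i u = act (plan_upto T k) i u.
Proof.
move=> ltik; elim: n => [|n IHn]; first by rewrite leqn0 => /eqP->.
rewrite leq_eqVlt => /orP[/eqP-> //|]; rewrite ltnS => kn nT arr us.
have lt_n := duration_gt0 _ (Tvalid.1 _ nT).
rewrite plan_uptoS (act_insert_before _ (srpt_upto_arrival nT)) ?lt_n ?(leq_trans ltik) //.
  by apply: IHn => // [|j kj jn]; [exact: ltnW|exact/arr/ltnW].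
by apply: le_lt_trans us _; exact: arr.
Qed.

(** Prices refer to the plan at an arrival, the backlog to the final plan; this monotonicity
    connects them. *)
Lemma finish_upto i k n : (i < k)%N -> (k <= n)%N -> (n <= size T)%N ->
  finish (plan_upto T k) i <= finish (plan_upto T n) i.
Proof.
move=> ltik; elim: n => [|n IHn]; first by rewrite leqn0 => /eqP->.
rewrite leq_eqVlt => /orP[/eqP-> //|]; rewrite ltnS => kn nT.
apply: le_trans (IHn kn (ltnW nT)) _.
have lt_n := duration_gt0 _ (Tvalid.1 _ nT).
rewrite plan_uptoS; set mu := dispatch _ _ _.
by have /andP[] := finish_insert_ge (plan_upto T n) mu (arrival (tau n)) (lt_n mu)
  (leq_trans ltik kn).
Qed.

Lemma service_upto n i : (n <= size T)%N -> (i < n)%N ->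
  service (plan_upto T n) i = duration (tau i) (machine (plan_upto T n) i).
Proof.
elim: n => // n IHn nT; rewrite ltnS_eqVlt plan_uptoS => /orP[/eqP->|ltin].
  by rewrite machine_insert_new service_insert_new.
by rewrite machine_insert // service_insert // IHn // ltnW.
Qed.

Lemma released_upto n i : (n <= size T)%N -> (i < n)%N ->
  released (plan_upto T n) i (arrival (tau i)).
Proof.
elim: n => // n IHn nT; rewrite ltnS_eqVlt plan_uptoS => /orP[/eqP->|ltin].
  exact: released_insert_new.
apply: released_insert => //; last by apply: IHn => //; exact: ltnW.
by apply: duration_gt0; exact: Tvalid.1.
Qed.

End Run.

Lemma greedy_online : online p greedy.
Proof.
move=> T T' s k vT vT' kT kT' eqk arrT arrT' i ltik.
have machE : machine (plan_upto T (size T)) i = machine (plan_upto T' (size T')) i.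
  by rewrite (machine_upto _ ltik kT) (machine_upto _ ltik kT') (plan_upto_take kT kT').
split=> [u us|_] /=; last by rewrite machE.
rewrite machE (act_upto vT ltik kT (leqnn _) arrT us).
by rewrite (act_upto vT' ltik kT' (leqnn _) arrT' us) (plan_upto_take kT kT').
Qed.

Lemma greedy_feasible T : valid_tap p T -> feasible p T (greedy T).
Proof.
move=> vT; set P := plan_upto T (size T); set N := size T.
(* The list is sorted, so the last arrival serves as [b]; for an empty list the claim is vacuous. *)
have [b arr_b] : exists b, forall i, (i < N)%N -> arrival (nth (dtask R) T i) <= b.
  exists (arrival (nth (dtask R) T N.-1)) => i ltiN; apply: vT.2; last by rewrite ltn_predL; case: N ltiN.
  by case: N ltiN.
have wf : srpt P N b by apply: srpt_upto.
split=> [i ltiN|x] /=; last first.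
  rewrite -/P -/N -sum_speed (partition_big (fun i : 'I_N => machine P i) predT) //=.
  apply: ler_sum => mu _; rewrite (eq_bigr (fun i : 'I_N => speed mu * act P i x)).
    rewrite -mulr_sumr -[leRHS]mulr1 ler_wpM2l ?(srpt_capacity wf) //.
    exact/ltW/speed_gt0.
  by move=> i /eqP->.
rewrite -/P; have [lt_sf rel] := (srpt_lt wf ltiN, released_upto vT (leqnn _) ltiN).
have sp0 := speed_gt0 (machine P i).
have processedE s := integral_act s wf ltiN (ltW sp0).
have workE : speed (machine P i) * service P i =
    work (nth (dtask R) T i) (machine P i == ord0).
  by rewrite service_upto // speed_duration.
split; split.
- by apply: measurable_funM => //; exact: measurable_act.
- by move=> x; rewrite mulr_ge0 ?act_ge0 ?ltW.
- by move=> x xi; rewrite (act_released (ltW lt_sf) rel) ?mulr0.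
- by move=> /negbTE par x; rewrite /speed par mul1r (act_le1 _ wf).
- by move=> x fx; rewrite (act_finished wf) ?mulr0.
- rewrite /processed /= processedE -workE /rem rest_done // addr0 big_seq big1 ?subr0 // => I.
  by move=> /(srpt_past wf ltiN)[_ Is _]; rewrite rest_done // (le_trans Is) // ltW.
(* Before [finish] a positive length is left, which makes the inequality strict. *)
move=> s sf; rewrite /processed /= processedE -workE lte_fin ltr_pM2l // ltrBlDr ltrDl.
rewrite ltr_wpDl ?rest_gt0 ?sumr_ge0 // => I _; exact: rest_ge0.
Qed.

End Dispatch.
End Greedy.

(** * Insertion prices against an offline schedule *)

Section Competitive.
Set Implicit Arguments.
Unset Strict Implicit.
Unset Printing Implicit Defensive.
Local Open Scope classical_set_scope.
Variables (R : realType) (p : nat).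
Hypothesis p_ge2 : (2 <= p)%N.
Notation leb := (@lebesgue_measure R).

Section Price.
Variable T : TAP R.
Hypothesis Tvalid : valid_tap p T.
Let tau i := nth (dtask R) T i.
Let N := size T.
Let P := plan_upto p T N.

(** The dual variable of task [k]: its least insertion cost, evaluated at its arrival. *)
Definition price k : R :=
  let Q := plan_upto p T k in
  quote Q k (nth (dtask R) T k) (dispatch Q k (nth (dtask R) T k)).

(** Its integral over time is the total response time of the greedy schedule. *)
Definition backlog t : R := \sum_(i < N) busy (arrival (tau i)) (finish P i) t.

(** Telescoping of [insert_cost], whose term [r] cancels against the arrival time of the new
    task. *)
Lemma TRT_le_price : TRT T (greedy p T) <= \sum_(k < N) price k.
Proof.
suff h n : (n <= N)%N -> \sum_(i < n) (finish (plan_upto p T n) i - arrival (tau i)) <=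
    \sum_(k < n) price k by exact: h.
elim: n => [|n IHn] nN; first by rewrite !big_ord0.
have cost : \sum_(i < n.+1) finish (plan_upto p T n.+1) i <=
    \sum_(i < n) finish (plan_upto p T n) i + arrival (tau n) + price n.
  rewrite plan_uptoS; apply: insert_cost; first exact: srpt_upto_arrival.
  by apply: duration_gt0 => //; exact: Tvalid.1.
have := IHn (ltnW nN); rewrite !sumrB.
rewrite [\sum_(i < n.+1) arrival _]big_ord_recr [\sum_(i < n.+1) price _]big_ord_recr /=.
move: cost; lra.
Qed.

Lemma price_le k mu t : (k < N)%N -> arrival (tau k) <= t ->
  price k <= (t - arrival (tau k)) + duration (tau k) mu *
    (1 + \sum_(i < N | machine P i == mu) busy (arrival (tau i)) (finish P i) t).
Proof.
move=> kN kt; have d0 := duration_gt0 p_ge2 mu (Tvalid.1 _ kN).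
apply: le_trans (dispatch_le _ _ _ mu) _.
have wf : srpt (plan_upto p T k) k (arrival (tau k)) by exact: srpt_upto_arrival.
apply: le_trans (marginal_le mu wf kt (ltW d0)) _.
apply: lerD => //; apply: ler_wpM2l; first exact: ltW.
apply: lerD => //.
rewrite (big_ord_widen_cond N (fun i => machine (plan_upto p T k) i == mu)
  (fun i => ((t < finish (plan_upto p T k) i)%R)%:R)) ?(ltnW kN) //.
rewrite [leLHS]big_mkcond [leRHS]big_mkcond; apply: ler_sum => i _ /=.
case: ifP => [/andP[/eqP <- ik]|_]; last by case: ifP => // _; exact: busy_ge0.
rewrite (machine_upto p T ik (ltnW kN)) eqxx /busy.
have -> /= : arrival (tau i) <= t by apply: le_trans kt; apply: Tvalid.2 => //; exact: ltnW.
rewrite ler_nat; case: ltP => //= tf; rewrite lt0b (lt_le_trans tf) //.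
by apply: finish_upto => //; exact: ltnW.
Qed.

(** A parallel job is compared with the fast machine, whose speed is at least [p / 2]. A serial job
    is compared with the average over the single processors, of which there are at least [p / 3];
    hence the factor 3. *)
Lemma price_backlog k (par : bool) t : (k < N)%N -> arrival (tau k) <= t ->
  price k <= (t - arrival (tau k)) + (if par then 2 / p%:R else 1) * work (tau k) par +
    3 * work (tau k) par / p%:R * backlog t.
Proof.
move=> kN kt; have [s0 sp _ _] := Tvalid.1 _ kN.
have p0 : 0 < p%:R :> R by rewrite ltr0n (leq_trans _ p_ge2).
have backlogE : backlog t =
    \sum_mu \sum_(i < N | machine P i == mu) busy (arrival (tau i)) (finish P i) t.
  by rewrite /backlog (partition_big (fun i : 'I_N => machine P i) predT).
have load0 mu : 0 <= \sum_(i < N | machine P i == mu) busy (arrival (tau i)) (finish P i) t.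
  by apply: sumr_ge0 => i _; exact: busy_ge0.
have backlog0 : 0 <= backlog t by apply: sumr_ge0 => i _; exact: busy_ge0.
case: par => /=.
  have v0 := speed_fast_gt0 R p_ge2.
  have := price_le ord0 kN kt; rewrite /duration eqxx.
  set v := (p - p./2)%:R in v0 *; set g := \sum_(i < N | _) _ => le_q.
  have g_le : g <= backlog t by rewrite backlogE (bigD1 ord0) //= lerDl sumr_ge0.
  have pv : p%:R <= 2 * v.
    by rewrite /v -natrM ler_nat; lia.
  have : par_work (tau k) / v <= 2 / p%:R * par_work (tau k).
    have h : 1 <= 2 / p%:R * v by rewrite mulrAC ler_pdivlMr // mul1r.
    by rewrite ler_pdivrMr // mulrAC ler_peMl //; lra.
  set d := _ / v in le_q *; move=> d_le.
  have d0 : 0 <= d by rewrite divr_ge0 ?ltW //; lra.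
  have : d * (1 + g) <= 2 / p%:R * par_work (tau k) * (1 + backlog t).
    apply: ler_pM => //; first by rewrite addr_ge0 // /g load0.
    by rewrite lerD2l; exact: g_le.
  have : 0 <= par_work (tau k) / p%:R * backlog t.
    by apply: mulr_ge0 => //; apply: divr_ge0; lra.
  rewrite /work; lra.
have m0 : 0 < (p./2)%:R :> R by rewrite ltr0n half_gt0.
(* Tight at [p = 3]; it relies on [p_ge2]. *)
have pm : p%:R <= 3 * (p./2)%:R :> R by rewrite -natrM ler_nat; lia.
have : \sum_(j < p./2) price k <=
    \sum_(j < p./2) ((t - arrival (tau k)) + serial_work (tau k) *
    (1 + \sum_(i < N | machine P i == lift ord0 j) busy (arrival (tau i)) (finish P i) t)).
  apply: ler_sum => j _; have := price_le (lift ord0 j) kN kt.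
  by rewrite /duration eq_sym (negbTE (neq_lift _ _)).
move: (price k) => q.
rewrite big_split /= -mulr_sumr [X in _ + _ * X]big_split /= !sumr_const card_ord -[q *+ _]mulr_natr -[(t - _) *+ _]mulr_natr.
set g := \sum_(j < p./2) _ => le_q.
have g_le : g <= backlog t by rewrite backlogE big_ord_recl lerDr.
have s_le : serial_work (tau k) * g <= serial_work (tau k) * backlog t.
  by apply: ler_wpM2l => //; exact: ltW.
rewrite /work mul1r -(ler_pM2r m0) [leRHS]mulrDl.
have h : 1 <= 3 / p%:R * (p./2)%:R :> R by rewrite mulrAC ler_pdivlMr // mul1r.
have : serial_work (tau k) * backlog t * 1 <=
    serial_work (tau k) * backlog t * (3 / p%:R * (p./2)%:R).
  by apply: ler_wpM2l => //; apply: mulr_ge0 => //; exact: ltW.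
move: le_q s_le; lra.
Qed.

End Price.
End Competitive.

(** * Volume bounds for an offline schedule *)

Section Offline.
Set Implicit Arguments.
Unset Strict Implicit.
Unset Printing Implicit Defensive.
Local Open Scope classical_set_scope.
Variables (R : realType) (p : nat).
Notation leb := (@lebesgue_measure R).
Variables (T : TAP R) (S : schedule R).
Hypothesis Sfeas : feasible p T S.
Let tau i := nth (dtask R) T i.
Let N := size T.

Lemma alloc_le_p i x : (i < N)%N -> sch_alloc S i x <= p%:R.
Proof.
move=> iN; apply: le_trans (Sfeas.2 x); rewrite (bigD1 (Ordinal iN)) //= lerDl.
by apply: sumr_ge0 => j _; have [[_ + _ _] _] := Sfeas.1 j (ltn_ord j); apply.
Qed.

Lemma integral_alloc i : (i < N)%N ->
  (\int[leb]_x (sch_alloc S i x)%:E)%E = (work (tau i) (sch_par S i))%:E.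
Proof.
move=> iN; have [_ [after <- _]] := Sfeas.1 i iN.
rewrite /processed [RHS]integral_indicM; apply: eq_integral => x _.
rewrite indicE; case: (boolP (x \in _)); first by rewrite mulr1.
by rewrite notin_setE /= => /negP; rewrite -ltNge => /after ->; rewrite mul0r.
Qed.

Lemma work_le_response i v : (i < N)%N -> 0 < work (tau i) (sch_par S i) -> 0 <= v ->
  (forall x, sch_alloc S i x <= v) ->
  work (tau i) (sch_par S i) <= v * (sch_compl S i - arrival (tau i)).
Proof.
move=> iN w0 v0 le_v; have [[my y0 before _] [after _ _]] := Sfeas.1 i iN.
set a := arrival _; set b := sch_compl S i.
have le_itv x : sch_alloc S i x <= v * \1_(`[a, b]) x.
  rewrite indicE mem_setE in_itv /=.
  have [ax|xa] := leP a x; last by rewrite before // mulr0.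
  by have [xb|bx] := leP x b; rewrite ?mulr1 ?le_v // after // mulr0.
have : (\int[leb]_x (sch_alloc S i x)%:E <= v%:E * leb `[a, b])%E.
  rewrite -[X in leb X]setIT -integral_indic // -ge0_integralZl_EFin //; last first.
    by apply/measurable_EFinP; exact: measurable_indic.
  apply: ge0_le_integral => //=.
  - by move=> x _; rewrite lee_fin.
  - exact/measurable_EFinP.
  - by apply/measurable_EFinP; apply: measurable_funM => //; exact: measurable_indic.
  - by move=> x _; rewrite -EFinM lee_fin.
rewrite integral_alloc //= lebesgue_measure_itv /= lte_fin.
(* If completion did not come after arrival, the interval would be null, against the positive
   work. *)
case: ltP => [_|_]; first by rewrite -EFinD -EFinM lee_fin.
by rewrite mule0 lee_fin leNgt w0.
Qed.

(** Exchange sum and integral; at each instant the allocations total at most [p]. *)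
Lemma sum_alloc_itv a b : a <= b ->
  \sum_(i < N) fine (\int[leb]_(x in `[a, b[) (sch_alloc S i x)%:E)%E <= p%:R * (b - a).
Proof.
move=> ab.
have my (i : 'I_N) : measurable_fun `[a, b[ (fun x => (sch_alloc S i x)%:E).
  apply/measurable_EFinP; apply: measurable_funTS.
  by have [[]] := Sfeas.1 i (ltn_ord i).
have y0 (i : 'I_N) x : 0 <= sch_alloc S i x.
  by have [[_ + _ _] _] := Sfeas.1 i (ltn_ord i); apply.
have y0e (i : 'I_N) x : (0 <= (sch_alloc S i x)%:E)%E by rewrite lee_fin.
have fin_y (i : 'I_N) : (\int[leb]_(x in `[a, b[) (sch_alloc S i x)%:E)%E \is a fin_num.
  rewrite ge0_fin_numE ?integral_ge0 //.
  apply: (@le_lt_trans _ _ (work (tau i) (sch_par S i))%:E); last exact: ltry.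
  rewrite -integral_alloc //; apply: ge0_subset_integral => //.
  by apply/measurable_EFinP; have [[]] := Sfeas.1 i (ltn_ord i).
rewrite -lee_fin -sumEFin.
rewrite (eq_bigr (fun i : 'I_N => \int[leb]_(x in `[a, b[) (sch_alloc S i x)%:E)%E);
  last by move=> i _; rewrite fineK.
rewrite -ge0_integral_sum //.
apply: (@le_trans _ _ (\int[leb]_(x in `[a, b[) (cst p%:R%:E x))%E).
  apply: ge0_le_integral => //.
  - by move=> x _; apply: sume_ge0.
  - exact: emeasurable_sum.
  - by move=> x _; rewrite sumEFin lee_fin; exact: Sfeas.2.
rewrite integral_cst //= lebesgue_measure_itv /= lte_fin.
case: ltgtP ab => // ->.
by rewrite mule0 subrr mulr0.
Qed.

End Offline.

(** * Dual fitting against the offline cost *)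

Section Main.
Set Implicit Arguments.
Unset Strict Implicit.
Unset Printing Implicit Defensive.
Local Open Scope classical_set_scope.
Variables (R : realType) (p : nat).
Hypothesis p_ge2 : (2 <= p)%N.
Notation leb := (@lebesgue_measure R).
Variable T : TAP R.
Hypothesis Tvalid : valid_tap p T.
Let tau i := nth (dtask R) T i.
Let N := size T.
Let P := plan_upto p T N.
Variable S : schedule R.
Hypothesis Sfeas : feasible p (scale_tap 6 T) S.
Let E (i : 'I_N) : set R := `[arrival (tau i), finish P i[.

Lemma nth_scale_tap i : (i < N)%N ->
  nth (dtask R) (scale_tap 6 T) i =
  Task (6 * serial_work (tau i)) (6 * par_work (tau i)) (arrival (tau i)).
Proof. by move=> iN; rewrite (nth_map (dtask R)). Qed.

(** [price_backlog] holds at every time when the offline schedule works on task [k], and there the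
    elapsed time is at most [D]. Average it against the offline allocation, of mass [6 * W]. *)
Lemma price_le_response k : (k < N)%N ->
  price p T k <= 2 * (sch_compl S k - arrival (tau k)) +
  1 / (2 * p%:R) * \sum_(i < N) fine (\int[leb]_(x in E i) (sch_alloc S k x)%:E)%E.
Proof.
move=> kN; have kN' : (k < size (scale_tap 6 T))%N by rewrite size_map.
have [s0 sp _ _] := Tvalid.1 _ kN; rewrite -/(tau k) in s0 sp.
have p0 : 0 < p%:R :> R by rewrite ltr0n (leq_trans _ p_ge2).
set D := _ - arrival _; set par := sch_par S k; set W := work (tau k) par.
set e := (if par then 2 / p%:R else 1) * W.
have W0 : 0 < W by rewrite /W /work; case: ifP => _; lra.
have workE : work (nth (dtask R) (scale_tap 6 T) k) par = 6 * W.
  by rewrite nth_scale_tap // /W /work; case: ifP.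
have [[my y0 before serial] [after _ _]] := Sfeas.1 k kN'.
rewrite nth_scale_tap //= in before.
have rate_le v : 0 <= v -> (forall x, sch_alloc S k x <= v) -> 6 * W <= v * D.
  move=> v0 le_v; have := work_le_response Sfeas kN' _ v0 le_v.
  rewrite -/par workE nth_scale_tap //=; apply; lra.
have e0 : 0 <= e.
  apply: mulr_ge0; last exact: ltW.
  by case: ifP => // _; apply: divr_ge0 => //; exact: ltW.
(* The offline rate is at most [p] for a parallel job and 1 for a serial one, so [6 * W] is at most
   [p * D], respectively [D]. *)
have eD : e <= D.
  rewrite /e; case: ifP => par_k.
    have := rate_le p%:R (ltW p0) (fun x => alloc_le_p Sfeas x kN').
    rewrite mulrAC ler_pdivrMr //; lra.
  have := rate_le 1 ler01 (serial (negbT par_k)); lra.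
have D0 : 0 <= D by apply: le_trans eD.
have price0 : 0 <= price p T k.
  have d0 (mu : 'I_(p./2).+1) : 0 <= duration (tau k) mu.
    by apply: ltW; apply: duration_gt0 => //; exact: (Tvalid.1 _ kN).
  apply: addr_ge0; first exact: d0.
  by apply: sumr_ge0 => i _; rewrite le_min rest_ge0; exact: d0.
have g0 : 0 <= 3 * W / p%:R.
  by apply: divr_ge0; [apply: mulr_ge0 => //|]; exact: ltW.
have yW : (\int[leb]_x (sch_alloc S k x)%:E)%E = (6 * W)%:E.
  by rewrite (integral_alloc Sfeas) // workE.
have mE i : measurable (E i) by exact: measurable_itv.
have := weighted_bound my y0 yW price0 (addr_ge0 D0 e0) g0 mE.
set I := \sum_(i < N) _ => bound.
have {bound} : 6 * W * price p T k <= 6 * W * (D + e) + 3 * W / p%:R * I.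
  apply: bound => x.
  have [kx|xk] := leP (arrival (tau k)) x; last by rewrite before // !mul0r.
  have [xC|Cx] := leP x (sch_compl S k); last by rewrite after // !mul0r.
  apply: ler_wpM2l => //; apply: le_trans (price_backlog p_ge2 Tvalid par kN kx) _.
  rewrite -/W -/e; apply: lerD; first by apply: lerD => //; rewrite lerB.
  apply: ler_wpM2l => //; rewrite /backlog.
  by apply: ler_sum => i _; rewrite busy_indic.
(* Here the speed enters: dividing [3 * W / p] by [6 * W] leaves [1 / (2 * p)]. *)
have -> : 6 * W * (D + e) + 3 * W / p%:R * I = 6 * W * (D + e + 1 / (2 * p%:R) * I).
  by field; rewrite gt_eqF.
rewrite ler_pM2l ?mulr_gt0 // => h; apply: le_trans h _; lra.
Qed.

(** After exchanging the sums, each task [i] collects the offline work done while it is alive, at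
    most [p] times its greedy response time. With the factor [1 / (2 * p)] this is half of the
    greedy cost, which is absorbed on the left. *)
Lemma greedy_competitive : TRT T (greedy p T) <= 4 * TRT (scale_tap 6 T) S.
Proof.
have p0 : 0 < p%:R :> R by rewrite ltr0n (leq_trans _ p_ge2).
have OPTE : TRT (scale_tap 6 T) S = \sum_(k < N) (sch_compl S k - arrival (tau k)).
  rewrite /TRT size_map; apply: eq_bigr => k _.
  by rewrite nth_scale_tap.
have : \sum_(i < N) \sum_(k < N) fine (\int[leb]_(x in E i) (sch_alloc S k x)%:E)%E <=
    \sum_(i < N) p%:R * (finish P i - arrival (tau i)).
  apply: ler_sum => i _; have := @sum_alloc_itv R p _ S Sfeas (arrival (tau i)) (finish P i).
  rewrite size_map; apply.
  (* Arrivals are nonnegative, so their sum is a time no earlier than any of them. *)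
  have wf : srpt P N (\sum_(i < N) arrival (tau i)).
    apply: srpt_upto => // j jN; rewrite (bigD1 (Ordinal jN)) //= lerDl.
    by apply: sumr_ge0 => l _; case: (Tvalid.1 _ (ltn_ord l)).
  have [rel _] := released_upto p_ge2 Tvalid (leqnn _) (ltn_ord i).
  by apply: le_trans rel _; rewrite ltW // (srpt_lt wf).
rewrite exchange_big -mulr_sumr /= => load.
have TRTE : TRT T (greedy p T) = \sum_(i < N) (finish P i - arrival (tau i)) by [].
have : TRT T (greedy p T) <= 2 * TRT (scale_tap 6 T) S + 1 / 2 * TRT T (greedy p T).
  apply: le_trans (TRT_le_price p_ge2 Tvalid) _.
  apply: (@le_trans _ _ (\sum_(k < N) (2 * (sch_compl S k - arrival (tau k)) + 1 / (2 * p%:R) *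
      \sum_(i < N) fine (\int[leb]_(x in E i) (sch_alloc S k x)%:E)%E))).
    by apply: ler_sum => k _; exact: price_le_response.
  rewrite big_split /= -!mulr_sumr OPTE lerD2l TRTE.
  rewrite [1 / 2 * _](_ : _ = 1 / (2 * p%:R) * (p%:R * \sum_(i < N) (finish P i - arrival (tau i)))).
    by apply: ler_wpM2l => //; rewrite divr_ge0 // mulr_ge0 // ltW.
  by field; rewrite gt_eqF.
lra.
Qed.

End Main.

Theorem theorem6p6 (R : realType) :
  exists c C : R, 1 <= c /\ 1 <= C /\
  exists p0 : nat, forall p : nat, (p0 <= p)%N ->
  exists ALG : TAP R -> schedule R,
    online p ALG /\
    forall T : TAP R, valid_tap p T ->
      feasible p T (ALG T) /\
      forall S : schedule R, feasible p (scale_tap c T) S ->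
        TRT T (ALG T) <= C * TRT (scale_tap c T) S.
Proof.
(* The speed 6 is twice the factor 3 of [price_backlog], so that the backlog share is one half; then
   4 is 2 divided by the remaining half. *)
exists 6, 4; split; first by lra.
split; first by lra.
(* From two processors on there is at least one serial machine besides the fast one. *)
exists 2%N => p p_ge2; exists (greedy p); split; first exact: greedy_online.
move=> T Tvalid; split; first exact: greedy_feasible.
by move=> S Sfeas; exact: greedy_competitive.
Qed.
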